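(* Fix a bandwidth-sharing network structure $(\mathbf A,\mathbf C,\boldsymbol\kappa)$ and $\alpha>0$, and consider the flow-vector Markov process $\mathbf N(\cdot)$ under the $\alpha$-fair policy with traffic parameters $(\boldsymbol\mu,\boldsymbol\nu)$ such that $\mathbf A\boldsymbol\rho<\mathbf C$ componentwise. Let $\varepsilon=\varepsilon(\boldsymbol\rho)$ be the gap and $\boldsymbol\pi$ the unique stationary distribution of $\mathbf N(\cdot)$. Then there exist positive constants $B,K,\xi$ such that for all $\ell\in\mathbb Z_+$, $$\mathbb P_{\boldsymbol\pi}\big(\|\mathbf N\|_\infty\ge B+2\xi\ell\big)\le\Big(\frac{\xi}{\xi+\varepsilon K}\Big)^{\ell+1}.$$ Here $\xi$ and $K$ are positive load-dependent constants, and $B$ takes the form $K'/\varepsilon$ when $\alpha\ge1$ and $K'/\min\{\varepsilon^{1/\alpha},\varepsilon\}$ when $\alpha\in(0,1)$, with $K'$ a positive load-dependent constant. In particular, all moments of $\|\mathbf N\|_\infty$ are finite under $\boldsymbol\pi$, i.e. $\mathbb E_{\boldsymbol\pi}[\|\mathbf N\|_\infty^k]<\infty$ for every $k\in\mathbb N$.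
   Context: Network. $\mathcal J$ is a finite set of resources and $\mathcal I$ a finite set of routes, each route being identified with a nonempty subset of $\mathcal J$. $\mathbf A$ is the $|\mathcal J|\times|\mathcal I|$ matrix with $A_{ji}=1$ if route $i$ uses resource $j$ and $A_{ji}=0$ otherwise; it has rank $|\mathcal J|$. $\mathbf C=(C_j)_{j\in\mathcal J}$ has positive entries (capacities), $\boldsymbol\kappa=(\kappa_i)_{i\in\mathcal I}$ has positive entries (weights), $\alpha>0$. Traffic parameters: $\nu_i>0$ (arrival rates), $\mu_i>0$ (service rates), $\rho_i=\nu_i/\mu_i$. $\alpha$-fair policy. For $\mathbf n\in\mathbb R_+^{|\mathcal I|}$ let $\mathcal I_+(\mathbf n)=\{i:n_i>0\}$. Set $\Lambda_i(\mathbf n)=0$ for $i\notin\mathcal I_+(\mathbf n)$; if $\mathbf n\neq\mathbf 0$, $(\Lambda_i(\mathbf n))_{i\in\mathcal I_+(\mathbf n)}$ is the unique maximizer, over nonnegative vectors $(\Lambda_i)_{i\in\mathcal I_+(\mathbf n)}$ with $\sum_{i\in\mathcal I_+(\mathbf n)}A_{ji}\Lambda_i\le C_j$ for all $j\in\mathcal J$, of $\sum_{i\in\mathcal I_+(\mathbf n)}\kappa_i n_i^\alpha\frac{\Lambda_i^{1-\alpha}}{1-\alpha}$ if $\alpha\ne1$, and of $\sum_{i\in\mathcal I_+(\mathbf n)}\kappa_i n_i\log\Lambda_i$ if $\alpha=1$. Flow process. $\mathbf N(t)=(N_i(t))_{i\in\mathcal I}$ is the continuous-time Markov process on $\mathbb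 Z_+^{|\mathcal I|}$ with transition rates $\mathbf n\to\mathbf n+\mathbf e_i$ at rate $\nu_i$, $\mathbf n\to\mathbf n-\mathbf e_i$ at rate $\mu_i\Lambda_i(\mathbf n)$ if $n_i\ge1$, and no other transitions ($\mathbf e_i$ is the $i$th unit vector). It is known that if $\mathbf A\boldsymbol\rho<\mathbf C$ componentwise, $\mathbf N(\cdot)$ is irreducible and positive recurrent, hence has a unique stationary distribution $\boldsymbol\pi$; $\mathbb P_{\boldsymbol\pi},\mathbb E_{\boldsymbol\pi}$ denote probability and expectation when $\mathbf N$ is distributed as $\boldsymbol\pi$. $\|\mathbf n\|_\infty=\max_i|n_i|$. Gap. If $\mathbf A\boldsymbol\rho<\mathbf C$ componentwise, $\varepsilon(\boldsymbol\rho)=\sup\{\tilde\varepsilon>0:(1+\tilde\varepsilon)\mathbf A\boldsymbol\rho\le\mathbf C\}$. Load-dependent constant. With $(\mathbf A,\mathbf C,\boldsymbol\kappa,\alpha)$ fixed, a positive load-dependent constant is a quantity of the form $K=f(\boldsymbol\mu,\boldsymbol\nu)$, where $f:(0,\infty)^{|\mathcal I|}\times(0,\infty)^{|\mathcal I|}\to(0,\infty)$ is a continuous function determined by $(\mathbf A,\mathbf C,\boldsymbol\kappa,\alpha)$ only. *)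

(* Defs.v *)
From HB Require Import structures.
From mathcomp Require Import all_boot all_order all_algebra.
From mathcomp Require Import all_classical all_reals all_analysis.

Set Implicit Arguments.
Unset Strict Implicit.
Unset Printing Implicit Defensive.

Import Order.TTheory GRing.Theory Num.Theory.
Import numFieldNormedType.Exports.

Local Open Scope classical_set_scope.
Local Open Scope ring_scope.

Section Network.
Context {R : realType} {nJ nI : nat}.

(* A network with resources 'I_nJ and routes 'I_nI; [route i] is the set of
   resources used by route i. *)
Definition routing_mx (route : 'I_nI -> {set 'I_nJ}) : 'M[R]_(nJ, nI) :=
  \matrix_(j, i) (j \in route i)%:R.

Definition positive_cv {n : nat} (v : 'cV[R]_n) : Prop :=
  forall i, 0 < v i 0.

Definition traffic (mu nu : 'cV[R]_nI) : 'cV[R]_nI :=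
  \col_i (nu i 0 / mu i 0).

Definition strictly_subcritical (A : 'M[R]_(nJ, nI)) (C : 'cV[R]_nJ)
    (rho : 'cV[R]_nI) : Prop :=
  forall j, (A *m rho) j 0 < C j 0.

Definition gap (A : 'M[R]_(nJ, nI)) (C : 'cV[R]_nJ) (rho : 'cV[R]_nI) : R :=
  sup [set e | 0 < e /\ forall j, ((1 + e) *: (A *m rho)) j 0 <= C j 0].

Definition load_dependent (f : 'cV[R]_nI -> 'cV[R]_nI -> R) : Prop :=
  (forall mu nu, positive_cv mu -> positive_cv nu -> 0 < f mu nu) /\
  {within [set p : 'cV[R]_nI * 'cV[R]_nI | positive_cv p.1 /\ positive_cv p.2],
    continuous (fun p => f p.1 p.2)}.

(* The value x^(1-alpha)/(1-alpha), resp. log x, for x >= 0, with its limit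
   -oo at x = 0 when alpha >= 1.  The test x == 0 is needed for alpha > 1
   because 0 `^ r = 0 for every r != 0, including negative r. *)
Definition fair_utility (alpha x : R) : \bar R :=
  if (1 <= alpha) && (x == 0) then -oo%E
  else if alpha == 1 then (ln x)%:E
  else (x `^ (1 - alpha) / (1 - alpha))%:E.

(* The summation over [0 < n i 0] is over the set I_+(n). At alpha = 1 the
   weight kappa_i n_i^alpha is kappa_i n_i. *)
Definition fair_objective (kappa : 'cV[R]_nI) (alpha : R)
    (n L : 'cV[R]_nI) : \bar R :=
  (\sum_(i | (0 < n i 0)%R)
     (kappa i 0%R * n i 0%R `^ alpha)%:E * fair_utility alpha (L i 0%R))%E.

Definition feasible (A : 'M[R]_(nJ, nI)) (C : 'cV[R]_nJ)
    (n L : 'cV[R]_nI) : Prop :=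
  (forall i, 0 < n i 0 -> 0 <= L i 0) /\
  (forall j, \sum_(i | 0 < n i 0) A j i * L i 0 <= C j 0).

Definition is_fair_allocation (A : 'M[R]_(nJ, nI)) (C : 'cV[R]_nJ)
    (kappa : 'cV[R]_nI) (alpha : R) (n L : 'cV[R]_nI) : Prop :=
  [/\ forall i, ~~ (0 < n i 0) -> L i 0 = 0,
      feasible A C n L
    & forall L', feasible A C n L' ->
        (fair_objective kappa alpha n L' <= fair_objective kappa alpha n L)%E].

(* The maximizer is unique on I_+(n), so this determines Lambda n for every
   nonnegative n. *)
Definition is_fair_policy (A : 'M[R]_(nJ, nI)) (C : 'cV[R]_nJ)
    (kappa : 'cV[R]_nI) (alpha : R) (Lambda : 'cV[R]_nI -> 'cV[R]_nI) : Prop :=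
  forall n : 'cV[R]_nI, (forall i, 0 <= n i 0) ->
    is_fair_allocation A C kappa alpha n (Lambda n).

End Network.

Section FlowProcess.
Context {R : realType} {nI : nat}.

Definition state : choiceType := {ffun 'I_nI -> nat}.

Implicit Types m n : state.

Definition real_state m : 'cV[R]_nI := \col_i (m i)%:R.

Definition arrival m (i : 'I_nI) : state := [ffun k => (m k + (k == i))%N].
Definition departure m (i : 'I_nI) : state := [ffun k => (m k - (k == i))%N].

Definition departure_rate (mu : 'cV[R]_nI) (Lambda : 'cV[R]_nI -> 'cV[R]_nI)
    m (i : 'I_nI) : R :=
  if (0 < m i)%N then mu i 0 * Lambda (real_state m) i 0 else 0.

(* Transition rate from m to n for n != m; it is 0 at n = m, since truncated
   departures from an empty route have departure_rate 0. *)
Definition flow_rate (mu nu : 'cV[R]_nI) (Lambda : 'cV[R]_nI -> 'cV[R]_nI)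
    m n : R :=
  \sum_(i | arrival m i == n) nu i 0
  + \sum_(i | departure m i == n) departure_rate mu Lambda m i.

Definition exit_rate (mu nu : 'cV[R]_nI) (Lambda : 'cV[R]_nI -> 'cV[R]_nI)
    m : R :=
  \sum_i nu i 0 + \sum_i departure_rate mu Lambda m i.

Definition flow_generator (mu nu : 'cV[R]_nI)
    (Lambda : 'cV[R]_nI -> 'cV[R]_nI) m n : R :=
  flow_rate mu nu Lambda m n - (m == n)%:R * exit_rate mu nu Lambda m.

(* P t m n is the probability that N(s + t) = n given N(s) = m, for a
   time-homogeneous continuous-time Markov chain with generator Q. *)
Record is_transition_function (Q : state -> state -> R)
    (P : R -> state -> state -> R) : Prop := IsTransitionFunction {
  transition_ge0 : forall (t : R) m n, 0 <= t -> 0 <= P t m n;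
  transition_sum1 : forall (t : R) m, 0 <= t ->
    \esum_(n in [set: state]) (P t m n)%:E = 1%E;
  transition0 : forall m n, P 0 m n = (m == n)%:R;
  transitionD : forall (s t : R) m n, 0 <= s -> 0 <= t ->
    (P (s + t) m n)%:E = \esum_(k in [set: state]) (P s m k * P t k n)%:E;
  transition_rate : forall m n,
    (P h m n - (m == n)%:R) / h @[h --> 0^'+] --> Q m n
}.

Record is_stationary (P : R -> state -> state -> R) (pi : state -> R) : Prop :=
  IsStationary {
  stationary_ge0 : forall n, 0 <= pi n;
  stationary_sum1 : \esum_(n in [set: state]) (pi n)%:E = 1%E;
  stationary_invariant : forall (t : R) n, 0 <= t ->
    \esum_(m in [set: state]) (pi m * P t m n)%:E = (pi n)%:E
}.

Definition prob (pi : state -> R) (E : set state) : \bar R :=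
  \esum_(n in E) (pi n)%:E.

Definition expect (pi : state -> R) (f : state -> R) : \bar R :=
  \esum_(n in [set: state]) (pi n * f n)%:E.

Definition max_norm n : R := (\max_(i < nI) n i)%N%:R.

End FlowProcess.

Arguments state : clear implicits.

(* Main.v *)
(* Let L(n) = (sum_i w_i n_i^(1+alpha))^(1/(1+alpha)), with w_i proportional to
   kappa_i rho_i^(-alpha) / mu_i and w_i >= 1, so that L dominates the max norm.
   Since (1+eps) rho is feasible and the fair objective is concave, comparing it
   with the maximizer gives
     sum_i w_i n_i^alpha (mu_i Lambda_i - nu_i) >= eps sum_i w_i nu_i n_i^alpha.
   Concavity of s^(1/(1+alpha)) and convexity of x^(1+alpha) bound the drift of L
   by -eps c plus an error of order 1/L (alpha >= 1) or L^(-alpha) (alpha < 1),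
   hence by -eps c / 2 as soon as L >= B.
   Stationarity gives E_pi[Q g] <= 0 for every g >= 0 of finite support (only
   this half of pi Q = 0 is needed).  For g = M - min (max L c) M, it compares
   pi(c + xi <= L < M) with pi(c - xi < L < c + xi); letting M grow, the tail of L
   decreases by the factor xi / (xi + eps K) over each step of length 2 xi. *)

Require Import Defs.
From HB Require Import structures.
From mathcomp Require Import all_boot all_order all_algebra.
From mathcomp Require Import all_classical all_reals all_analysis.
From mathcomp Require Import ring lra.

Set Implicit Arguments.
Unset Strict Implicit.
Unset Printing Implicit Defensive.

Import Order.TTheory GRing.Theory Num.Theory.
Import numFieldNormedType.Exports.

Local Open Scope classical_set_scope.
Local Open Scope ring_scope.

(** * Tangent-line inequalities for powers and for the alpha-fair utility *)

Section PowerInequalities.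
Context {R : realType}.
Implicit Types a p r x y z : R.

Lemma expR_tangent x y : expR y * (1 + (x - y)) <= expR x.
Proof.
rewrite -[in leRHS](subrK y x) expRD mulrC ler_pM2r ?expR_gt0//.
exact: expR_ge1Dx.
Qed.

(** Jensen for [expR]: its tangent at [v] is evaluated at [ln z] with weight r and at 0 with weight
    1 - r. The first-order terms cancel because [v] is that weighted mean. *)
Lemma powR_le_tangent1 r z : 0 <= r -> r <= 1 -> 0 < z ->
  z `^ r <= 1 + r * (z - 1).
Proof.
move=> r0 r1 z0; rewrite /powR gt_eqF//; set v := r * ln z.
have := expR_tangent (ln z) v; rewrite lnK ?posrE// => h1.
have := expR_tangent 0 v; rewrite expR0 => h2.
have h3 : r * (expR v * (1 + (ln z - v))) <= r * z by rewrite ler_wpM2l.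
have h4 : (1 - r) * (expR v * (1 + (0 - v))) <= (1 - r) * 1.
  by rewrite ler_wpM2l// subr_ge0.
have -> : expR v = r * (expR v * (1 + (ln z - v))) +
    (1 - r) * (expR v * (1 + (0 - v))) by rewrite /v; ring.
lra.
Qed.

(** The tangent of [expR] at 0 is used twice: z^r >= 1 + r ln z, and ln z <= z - 1, which changes
    direction under the factor r <= 0. *)
Lemma powR_ge_tangent1_neg r z : r <= 0 -> 0 < z ->
  1 + r * (z - 1) <= z `^ r.
Proof.
move=> r0 z0; rewrite /powR gt_eqF//.
have := expR_tangent (r * ln z) 0; have := expR_tangent (ln z) 0.
rewrite expR0 lnK ?posrE// => h1 h2; nra.
Qed.

(** The concave case with exponent 1/r, taken at the point z^r and solved for z^r. *)
Lemma powR_ge_tangent1 r z : 1 <= r -> 0 < z -> 1 + r * (z - 1) <= z `^ r.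
Proof.
move=> r1 z0; have r0 : 0 < r by lra.
have rV0 : 0 <= r^-1 by rewrite invr_ge0 ltW.
have rV1 : r^-1 <= 1 by rewrite invf_le1.
have := powR_le_tangent1 rV0 rV1 (powR_gt0 r z0).
rewrite -powRrM divff ?gt_eqF// (powRr1 (ltW z0)) -(ler_pM2l r0) mulrDr mulrA divff ?gt_eqF//; lra.
Qed.

Lemma powR_scale r x y : 0 < x -> 0 <= y -> y `^ r = x `^ r * (y / x) `^ r.
Proof.
move=> x0 y0; rewrite -powRM ?divr_ge0 ?(ltW x0)//.
by rewrite mulrCA divff ?gt_eqF ?mulr1.
Qed.

(** Homogeneity moves the point of tangency from x to 1. *)
Lemma tangent_scale r x y : 0 < x ->
  x `^ r + r * x `^ (r - 1) * (y - x) = x `^ r * (1 + r * (y / x - 1)).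
Proof.
move=> x0; rewrite powRB ?(gt_eqF x0) ?implybT// (powRr1 (ltW x0)).
by field; rewrite gt_eqF.
Qed.

Lemma powR_le_tangent r x y : 0 < r -> r <= 1 -> 0 < x -> 0 <= y ->
  y `^ r <= x `^ r + r * x `^ (r - 1) * (y - x).
Proof.
move=> r0 r1 x0; rewrite tangent_scale// le_eqVlt => /predU1P[<-|y0].
  by rewrite powR0 ?gt_eqF// mulr_ge0 ?powR_ge0//; lra.
rewrite (powR_scale r x0 (ltW y0)) ler_pM2l ?powR_gt0//.
by apply: powR_le_tangent1; rewrite ?divr_gt0// ltW.
Qed.

Lemma powR_ge_tangent r x y : 1 <= r -> 0 <= x -> 0 <= y ->
  x `^ r + r * x `^ (r - 1) * (y - x) <= y `^ r.
Proof.
move=> r1; have r0 : 0 < r by lra.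
rewrite le_eqVlt => /predU1P[<-|x0]; rewrite le_eqVlt => /predU1P[<-|y0].
- by rewrite subrr mulr0 addr0.
- rewrite (powR0 (negbT (gt_eqF r0))) add0r subr0.
  (* At the point of tangency 0 the slope contains 0^(r - 1), which is 1 for r = 1 and 0 for r >
     1. *)
  have [->|rn1] := eqVneq r 1; first by rewrite subrr powRr0 powRr1 ?(ltW y0)// !mul1r.
  by rewrite powR0 ?subr_eq0// mulr0 mul0r powR_ge0.
- rewrite tangent_scale// (powR0 (negbT (gt_eqF r0))) mul0r.
  by rewrite mulr_ge0_le0 ?powR_ge0//; lra.
rewrite tangent_scale// (powR_scale r x0 (ltW y0)) ler_pM2l ?powR_gt0//.
by apply: powR_ge_tangent1; rewrite ?divr_gt0.
Qed.

Lemma powR_ge_tangent_neg r x y : r <= 0 -> 0 < x -> 0 < y ->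
  x `^ r + r * x `^ (r - 1) * (y - x) <= y `^ r.
Proof.
move=> r0 x0 y0.
rewrite tangent_scale// (powR_scale r x0 (ltW y0)) ler_pM2l ?powR_gt0//.
by apply: powR_ge_tangent1_neg; rewrite ?divr_gt0.
Qed.

(** Convex powers are bounded by the slope at the right end x + 1, concave ones by subadditivity.
    This increment becomes [error_term] in the drift estimate. *)
Lemma powR_succ_le a x M : 0 < a -> 0 <= x -> x + 1 <= M ->
  (x + 1) `^ a <= x `^ a + (if 1 <= a then a * M `^ (a - 1) else 1).
Proof.
move=> a0 x0 xM; case: ifPn => a1.
  have x1 : 0 <= x + 1 by lra.
  have := powR_ge_tangent a1 x1 x0.
  have h : (x + 1) `^ (a - 1) <= M `^ (a - 1).
    by apply: ge0_ler_powR; rewrite ?nnegrE; lra.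
  have := @ler_wpM2l _ a (ltW a0) _ _ h; lra.
move: a1; rewrite -ltNge => a1.
have [->|xn0] := eqVneq x 0; first by rewrite add0r powR1 lerDr powR_ge0.
have xp : 0 < x by rewrite lt_def xn0.
(* Subadditivity of [z `^ a]: compare with [z * (x+1) `^ (a-1)] at z = x, 1. *)
have sub z : 0 < z -> z <= x + 1 -> z * (x + 1) `^ (a - 1) <= z `^ a.
  move=> z0 zx; rewrite -(mulr_powRB1 (ltW z0) a0) ler_pM2l//.
  have x1 : 0 < x + 1 by lra.
  rewrite -opprB !powRN lef_pV2 ?posrE ?powR_gt0//.
  by apply: ge0_ler_powR; rewrite ?nnegrE; lra.
have x1 : 0 <= x + 1 by lra.
rewrite -(mulr_powRB1 x1 a0) mulrDl.
have xx : x <= x + 1 by lra.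
have x11 : 1 <= x + 1 by lra.
have := sub x xp xx; have := sub 1 ltr01 x11.
rewrite powR1; lra.
Qed.

(** The utility is concave with derivative y^(-a). Division by 1 - a gives the same inequality from
    the concave power (a < 1) and from the convex negative power (a > 1); for a >= 1 and x = 0 the
    left side is -oo. *)
Lemma fair_utility_le_tangent a x y : 0 < a -> 0 <= x -> 0 < y ->
  fair_utility a y = (if a == 1 then ln y else y `^ (1 - a) / (1 - a))%:E /\
  (fair_utility a x <= ((if a == 1 then ln y else y `^ (1 - a) / (1 - a)) +
     y `^ (- a) * (x - y))%:E)%E.
Proof.
move=> a0 x0 y0; rewrite /fair_utility (gt_eqF y0) andbF.
split; first by case: ifP.
case: ifPn => [_|]; first exact: leNye.
rewrite negb_and -ltNge => a1x.
case: ifPn => [/eqP a1|an1]; rewrite lee_fin.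
  have xp : 0 < x by rewrite lt_def x0 andbT; move: a1x; rewrite a1 ltxx.
  rewrite a1 (powR_inv1 (ltW y0)).
  have := expR_ge1Dx (ln (x / y)); rewrite lnK ?posrE ?divr_gt0//.
  rewrite ln_div ?posrE// mulrBr mulVf ?gt_eqF// mulrC; lra.
rewrite [in _ `^ (- a)](_ : - a = (1 - a) - 1); last by ring.
have [a1|a1] := ltP a 1.
  have h : 0 < 1 - a by lra.
  rewrite ler_pdivrMr// mulrDl mulfVK ?gt_eqF//.
  have h1 : 1 - a <= 1 by lra.
  have := powR_le_tangent h h1 y0 x0; lra.
have ap : 1 < a by rewrite lt_def an1.
have xp : 0 < x by rewrite lt_def x0 andbT; move: a1x; rewrite ltNge a1.
have h : 1 - a < 0 by lra.
rewrite ler_ndivrMr// mulrDl mulfVK ?lt_eqF//.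
have := powR_ge_tangent_neg (ltW h) y0 xp; lra.
Qed.

End PowerInequalities.

(** * Finite partial sums, and moments from geometric tails *)

Section FiniteSums.
Context {R : realType} {T : choiceType}.
Implicit Types (a : T -> R) (E : set T) (s : seq T).

Lemma esum_le_finite a E X :
  (forall s, uniq s -> {in s, forall x, E x} -> \sum_(x <- s) a x <= X) ->
  (\esum_(x in E) (a x)%:E <= X%:E)%E.
Proof.
move=> aX; apply: ge_ereal_sup => _ [F [finF FE] <-].
rewrite fsbig_finite//= sumEFin lee_fin; apply: aX => // x.
by rewrite in_fset_set// inE => /FE.
Qed.

Lemma finite_le_esum a E s : uniq s -> {in s, forall x, E x} ->
  ((\sum_(x <- s) a x)%:E <= \esum_(x in E) (a x)%:E)%E.
Proof.
move=> us sE; apply: ereal_sup_ubound; exists [set` s].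
  by split; [exact: finite_seq|move=> x /= /sE].
by rewrite -fsbig_seq// sumEFin.
Qed.

Lemma sum_indicator_seq s0 s a : uniq s0 -> uniq s -> {subset s <= s0} ->
  \sum_(x <- s0) a x * (x \in s)%:R = \sum_(x <- s) a x.
Proof.
move=> us0 us ss0; have e : perm_eq [seq x <- s0 | x \in s] s.
  apply: uniq_perm; rewrite ?filter_uniq// => x; rewrite mem_filter.
  by have [/ss0->|] := boolP (x \in s).
rewrite -(perm_big _ e) big_filter [RHS]big_mkcond; apply: eq_bigr => x _.
by case: ifP; rewrite ?mulr1 ?mulr0.
Qed.

Lemma sum_delta_seq s a x (c : R) : uniq s -> (x \notin s -> a x = 0) ->
  \sum_(y <- s) (if x == y then c else 0) * a y = c * a x.
Proof.
move=> us ax0; have [xs|xs] := boolP (x \in s).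
  rewrite (bigD1_seq x)//= eqxx big1 ?addr0// => y yx.
  by rewrite eq_sym (negbTE yx) mul0r.
rewrite (ax0 xs) mulr0 big_seq big1// => y ys.
by case: eqP xs => [->|]; rewrite ?ys ?mul0r.
Qed.

(* Summing by layers [B + 2 xi l <= X] reduces moments to the tail bound. *)
Lemma moment_of_geometric_tail (p : T -> R) (X : T -> R) (B xi r : R) (k : nat) :
  0 <= B -> 0 < xi -> 0 < r < 1 -> (forall x, 0 <= p x) -> (forall x, 0 <= X x) ->
  (forall s, uniq s -> \sum_(x <- s) p x <= 1) ->
  (forall l s, uniq s -> {in s, forall x, B + 2 * xi * l%:R <= X x} ->
     \sum_(x <- s) p x <= r ^+ l.+1) ->
  exists D : R, forall s, uniq s -> \sum_(x <- s) p x * X x ^+ k <= D.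
Proof.
move=> B0 xi0 /andP[r0 r1] p0 X0 p1 tail.
(* Here t = r^(-1/2): the layer weights t^l outgrow every polynomial, while r t = r^(1/2) < 1 keeps
   the weighted tails summable. *)
pose e : R := - ln r / 2; pose t : R := expR e.
have e0 : 0 < e by rewrite /e divr_gt0// oppr_gt0 ln_lt0// r0.
have rt : r * t < 1.
  have -> : r = expR (- e - e) by rewrite -{1}(lnK r0); congr expR; rewrite /e; field.
  by rewrite -expRD addrNK expR_lt1 oppr_lt0.
have t0 : 0 < t by exact: expR_gt0.
(* Small enough that the k-th power of [expR (b * N%:R)] stays below t^N; the denominator k + 1 also
   covers k = 0. *)
pose b := e / k.+1%:R.
have b0 : 0 < b by rewrite divr_gt0.
pose D0 := (B + 2 * xi + 2 * xi / b) ^+ k.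
have xib : 0 < xi / b by rewrite divr_gt0.
have D00 : 0 <= D0 by apply: exprn_ge0; lra.
have growth N : (B + 2 * xi * N.+1%:R) ^+ k <= D0 * t ^+ N.
  have N0 : 0 <= N%:R :> R by [].
  apply: (@le_trans _ _ (D0 * expR (b * N%:R) ^+ k)); last first.
    rewrite ler_wpM2l// -!expRM_natr ler_expR /b.
    rewrite [leLHS](_ : _ = e * N%:R * (k%:R / k.+1%:R)); last by ring.
    apply: ler_piMr; first by rewrite mulr_ge0// ltW.
    by rewrite ler_pdivrMr// mul1r ler_nat.
  rewrite -exprMn lerXn2r ?nnegrE//.
  - by rewrite addr_ge0// !mulr_ge0// ltW.
  - by rewrite mulr_ge0 ?expR_ge0//; lra.
  have h := @expR_ge1Dx R (b * N%:R).
  apply: (@le_trans _ _ ((B + 2 * xi + 2 * xi / b) * (1 + b * N%:R))); last first.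
    by rewrite ler_wpM2l//; lra.
  rewrite [leLHS](_ : _ = B + 2 * xi + 2 * (xi / b) * (b * N%:R)); last first.
    by rewrite -natr1; field; rewrite gt_eqF.
  have bN : 0 <= b * N%:R by rewrite mulr_ge0// ltW.
  have : 0 <= B * (b * N%:R) by rewrite mulr_ge0.
  have : 0 <= xi * (b * N%:R) by rewrite mulr_ge0// ltW.
  rewrite -[2 * xi / b]mulrA; move: (xi / b) xib (b * N%:R) bN => u u0 y y0; lra.
(* Each layer reached by X contributes t^l; by [growth] the last layer reached already dominates X^k
   up to [D0]. *)
pose layers N (x : T) : R := \sum_(l < N) (B + 2 * xi * l%:R <= X x)%R%:R * t ^+ l.
have layers0 N x : 0 <= layers N x.
  by apply: sumr_ge0 => l _; rewrite mulr_ge0// exprn_ge0// ltW.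
have pointwise N x : X x < B + 2 * xi * N%:R -> X x ^+ k <= D0 * (1 + layers N x).
  elim: N => [|N IHN] xN.
    rewrite /layers big_ord0 addr0 mulr1 lerXn2r ?nnegrE//; first lra.
    by move: xN; rewrite mulr0; lra.
  have [xN1|xN1] := ltP (X x) (B + 2 * xi * N%:R).
    apply: (le_trans (IHN xN1)); rewrite ler_wpM2l// lerD2l /layers big_ord_recr/=.
    by rewrite lerDl mulr_ge0// exprn_ge0// ltW.
  rewrite /layers big_ord_recr/= xN1 mul1r.
  apply: (@le_trans _ _ (D0 * t ^+ N)).
    apply: le_trans (growth N); rewrite lerXn2r ?nnegrE//; last exact: ltW.
    by rewrite addr_ge0// !mulr_ge0// ltW.
  by rewrite ler_wpM2l// addrA lerDr addr_ge0//; exact: layers0.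
exists (D0 * (1 + (1 - r * t)^-1)) => s us.
(* The total of X over s bounds each of its values, so N layers cover the whole list. *)
pose N := (Num.truncn ((\sum_(x <- s) X x) / (2 * xi))).+1.
have XN x : x \in s -> X x < B + 2 * xi * N%:R.
  move=> xs; have hx : X x <= \sum_(x <- s) X x.
    by rewrite (bigD1_seq x)//= lerDl sumr_ge0.
  have := truncnS_gt ((\sum_(x <- s) X x) / (2 * xi)).
  rewrite -/N ltr_pdivrMr ?mulr_gt0// => hN.
  rewrite [_ * N%:R]mulrC; lra.
apply: (@le_trans _ _ (\sum_(x <- s) D0 * (p x + p x * layers N x))).
  rewrite !big_seq; apply: ler_sum => x xs.
  rewrite -[X in _ * (X + _)]mulr1 -mulrDr mulrCA ler_wpM2l//.
  exact/pointwise/XN.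
rewrite -mulr_sumr ler_wpM2l// big_split/= lerD// ?p1//.
under eq_bigr do rewrite /layers mulr_sumr.
rewrite exchange_big/=.
apply: (@le_trans _ _ (\sum_(l < N) (r * t) ^+ l)).
  apply: ler_sum => l _.
  rewrite (eq_bigr (fun x => t ^+ l * (p x * (B + 2 * xi * l%:R <= X x)%R%:R))); last first.
    by move=> x _; rewrite mulrA mulrC.
  rewrite -mulr_sumr exprMn mulrC ler_wpM2r ?exprn_ge0 ?(ltW t0)//.
  rewrite (eq_bigr (fun x => if B + 2 * xi * l%:R <= X x then p x else 0)); last first.
    by move=> x _; case: ifP; rewrite ?mulr1 ?mulr0.
  rewrite -big_mkcond -big_filter/=.
  apply: (@le_trans _ _ (r ^+ l.+1)); last by rewrite exprS ler_piMl ?exprn_ge0// ltW.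
  by apply: tail; rewrite ?filter_uniq// => x; rewrite mem_filter => /andP[].
rewrite -[leRHS]mul1r ler_pdivlMr ?subr_gt0//.
have -> : (\sum_(l < N) (r * t) ^+ l) * (1 - r * t) = 1 - (r * t) ^+ N.
  by rewrite -opprB mulrN mulrC -subrX1 opprB.
by rewrite gerBl exprn_ge0// mulr_ge0// ltW.
Qed.

End FiniteSums.

Lemma clamp_lipschitz {R : realType} (c M z z' : R) : c <= M -> z <= z' ->
  0 <= Num.min (Num.max z' c) M - Num.min (Num.max z c) M <= z' - z.
Proof.
move=> cM zz'; case: (leP z c) => h1; case: (leP z' c) => h2;
  case: (leP c M) => h3; case: (leP z M) => h4; case: (leP z' M) => h5; lra.
Qed.

(** * The generator acting on functions, and tails from negative drift *)

Section Balance.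
Context {R : realType} {nI : nat}.
Variables (mu nu : 'cV[R]_nI) (Lambda : 'cV[R]_nI -> 'cV[R]_nI).
Variables (P : R -> state nI -> state nI -> R) (pi : state nI -> R).
Implicit Types (m n : state nI) (f g : state nI -> R) (s : seq (state nI)).

(** The generator applied to f, summed over jumps so that it is meaningful for f of infinite
    support. *)
Definition drift f m : R :=
  \sum_i nu i 0 * (f (arrival m i) - f m) +
  \sum_i departure_rate mu Lambda m i * (f (departure m i) - f m).

Lemma departure_arrival m i : (0 < m i)%N -> arrival (departure m i) i = m.
Proof.
move=> mi; apply/ffunP => k; rewrite !ffunE; case: eqP => [->|_].
  by rewrite addn1 subn1 prednK.
by rewrite subn0 addn0.
Qed.

Lemma driftB M f m : drift (fun x => M - f x) m = - drift f m.
Proof.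
rewrite /drift [RHS]opprD -!sumrN.
by congr (_ + _); apply: eq_bigr => i _; ring.
Qed.

(** Every jump target where g is nonzero lies in s, so the list captures the whole row; the diagonal
    of the generator supplies the terms in g m. *)
Lemma sum_flow_generator s g m : uniq s -> m \in s ->
  (forall n, n \notin s -> g n = 0) ->
  \sum_(n <- s) flow_generator mu nu Lambda m n * g n = drift g m.
Proof.
move=> us ms g0.
have sumE (c : 'I_nI -> R) (h : 'I_nI -> state nI) :
    \sum_(n <- s) (\sum_(i | h i == n) c i) * g n = \sum_i c i * g (h i).
  under eq_bigr do rewrite big_mkcond mulr_suml.
  rewrite exchange_big/=; apply: eq_bigr => i _.
  by rewrite sum_delta_seq// => /g0.
rewrite (eq_bigr (fun n => (\sum_(i | arrival m i == n) nu i 0) * g n +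
  (\sum_(i | departure m i == n) departure_rate mu Lambda m i) * g n -
  (if m == n then exit_rate mu nu Lambda m else 0) * g n)); last first.
  move=> n _; rewrite /flow_generator /flow_rate mulrBl mulrDl.
  by case: eqP; rewrite ?mul1r ?mul0r.
rewrite big_split/= sumrN big_split/= !sumE sum_delta_seq; [|by []|by move/g0].
rewrite /drift /exit_rate mulrDl opprD addrACA !mulr_suml -!sumrB.
by congr (_ + _); apply: eq_bigr => i _; ring.
Qed.

Hypothesis nu_ge0 : forall i, 0 <= nu i 0.

Lemma drift_le f m (u d : 'I_nI -> R) :
  (forall i, 0 <= departure_rate mu Lambda m i) ->
  (forall i, f (arrival m i) - f m <= u i) ->
  (forall i, (0 < m i)%N -> f (departure m i) - f m <= d i) ->
  drift f m <= \sum_i nu i 0 * u i + \sum_i departure_rate mu Lambda m i * d i.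
Proof.
move=> rate_ge0 fu fd; apply: lerD; apply: ler_sum => i _; first exact: ler_wpM2l.
rewrite /departure_rate; case: ifPn => mi; last by rewrite !mul0r.
by apply: ler_wpM2l; [have := rate_ge0 i; rewrite /departure_rate mi|exact: fd].
Qed.

Hypothesis trP : is_transition_function (flow_generator mu nu Lambda) P.
Hypothesis stP : is_stationary P pi.

Lemma sum_stationary_le1 s : uniq s -> \sum_(x <- s) pi x <= 1.
Proof.
move=> us; rewrite -lee_fin -(stationary_sum1 stP).
exact: finite_le_esum.
Qed.

(* Differentiating [sum_(m <- s) pi m * P h m n <= pi n] at h = 0. *)
Lemma stationary_generator_le0 s n : uniq s -> n \in s ->
  \sum_(m <- s) pi m * flow_generator mu nu Lambda m n <= 0.
Proof.
move=> us ns.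
have lim : \sum_(m <- s) pi m * ((P h m n - (m == n)%:R) / h) @[h --> 0^'+]
    --> \sum_(m <- s) pi m * flow_generator mu nu Lambda m n.
  apply: cvg_big => [|m _]; first exact: add_continuous.
  by apply: cvgMl_tmp; exact: (transition_rate trP).
apply: (cvgr_to_le lim); near=> h.
have h0 : 0 < h by near: h; exact: nbhs_right_gt.
under eq_bigr do rewrite mulrA mulrBr.
rewrite -mulr_suml pmulr_lle0 ?invr_gt0// sumrB subr_le0.
rewrite [leRHS](_ : _ = pi n); last first.
  rewrite (bigD1_seq n)//= eqxx mulr1 big1 ?addr0// => m /negbTE ->.
  by rewrite mulr0.
rewrite -lee_fin -(stationary_invariant stP n (ltW h0)).
exact: finite_le_esum.
Unshelve. all: by end_near.
Qed.

(** Exchanging two finite sums turns the left side into the column sums of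
    [stationary_generator_le0], weighted by g n >= 0. *)
Lemma stationary_drift_le0 s g : uniq s -> (forall n, 0 <= g n) ->
  (forall n, n \notin s -> g n = 0) -> \sum_(m <- s) pi m * drift g m <= 0.
Proof.
move=> us g0 gs.
have -> : \sum_(m <- s) pi m * drift g m = \sum_(n <- s) g n *
    \sum_(m <- s) pi m * flow_generator mu nu Lambda m n.
  under [RHS]eq_bigr do rewrite mulr_sumr.
  rewrite exchange_big/= !big_seq; apply: eq_bigr => m ms.
  rewrite -(sum_flow_generator us ms gs) mulr_sumr.
  by apply: eq_bigr => n _; ring.
rewrite big_seq; apply: sumr_le0 => n ns.
by rewrite mulr_ge0_le0// stationary_generator_le0.
Qed.

Hypothesis rate_ge0 : forall m i, 0 <= departure_rate mu Lambda m i.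

(* Stationarity applied to [min (max L c) M], which only moves when L does, by
   at most xi per unit of time just around the level c. *)
Lemma level_crossing (L : state nI -> R) (J xi gam c T : R) :
  0 <= J -> J <= xi -> J * \sum_i nu i 0 <= xi -> 0 <= gam ->
  (forall m i, L m <= L (arrival m i)) ->
  (forall m i, L (arrival m i) <= L m + J) ->
  (forall m, c + xi <= L m -> drift L m <= - gam) ->
  (forall M, exists2 s, uniq s & forall n, L n < M -> n \in s) ->
  (forall s, uniq s -> {in s, forall n, c - xi < L n} -> \sum_(n <- s) pi n <= T) ->
  forall s, uniq s -> {in s, forall n, c + xi <= L n} ->
  (xi + gam) * \sum_(n <- s) pi n <= xi * T.
Proof.
move=> J0 Jxi Jnu gam0 Lup LJ Ldrift Lfin cT s us sL.
have xi0 : 0 <= xi by exact: le_trans Jxi.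
have Ldn m i : (0 < m i)%N -> L (departure m i) <= L m.
  by move=> mi; rewrite -{2}(departure_arrival mi).
have LdJ m i : (0 < m i)%N -> L m - J <= L (departure m i).
  by move=> mi; rewrite -{1}(departure_arrival mi) lerBlDr.
(* A truncation level above [c + xi] and above every value of L on s. *)
pose M := `|c + xi| + 1 + \sum_(x <- s) `|L x|.
have sM x : x \in s -> L x < M.
  move=> xs; have : `|L x| <= \sum_(x <- s) `|L x|.
    by rewrite (bigD1_seq x)//= lerDl sumr_ge0.
  by have := ler_norm (L x); have := normr_ge0 (c + xi); rewrite /M; lra.
have cM : c + xi < M.
  have : 0 <= \sum_(x <- s) `|L x| by rewrite sumr_ge0.
  by have := ler_norm (c + xi); rewrite /M; lra.
pose clamp z := Num.min (Num.max z c) M.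
have clamp_lip z z' : z <= z' -> 0 <= clamp z' - clamp z <= z' - z.
  by apply: clamp_lipschitz; lra.
have clamp_low z : z <= c -> clamp z = c.
  by move=> zc; rewrite /clamp max_r ?min_l//; lra.
have clamp_id z : c <= z -> z <= M -> clamp z = z.
  by move=> cz zM; rewrite /clamp max_l ?min_l.
pose f n := clamp (L n).
have [sb usb sbP] := Lfin M.
pose s0 := undup (sb ++ s).
have us0 : uniq s0 by rewrite undup_uniq.
have ss0 : {subset s <= s0} by move=> x xs; rewrite mem_undup mem_cat xs orbT.
have s0P n : n \notin s0 -> M - f n = 0.
  rewrite mem_undup mem_cat negb_or => /andP[nsb _].
  have ML : M <= L n by rewrite leNgt; apply: contra nsb => /sbP.
  by rewrite /f /clamp min_r ?subrr// le_max ML.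
have fM n : f n <= M by rewrite ge_min lexx orbT.
have cf n : c <= f n by rewrite le_min le_max lexx orbT/=; lra.
have Pi0 := stationary_ge0 stP.
(* The function M - f is nonnegative and vanishes off [s0], so stationarity applies to it; the sign
   flips on passing to f. *)
have flux : 0 <= \sum_(m <- s0) pi m * drift f m.
  have := @stationary_drift_le0 s0 (fun n => M - f n) us0 _ s0P.
  under eq_bigr do rewrite driftB mulrN.
  rewrite sumrN oppr_le0; apply=> n; rewrite subr_ge0; exact: fM.
(* At the top f can only decrease; below c - xi an upward jump of at most J <= xi does not pass c,
   where f is constant. *)
have fconst m : f m = M \/ L m <= c - xi -> drift f m <= 0.
  move=> fm; have := @drift_le f m (fun=> 0) (fun=> 0) (rate_ge0 m).
  under eq_bigr do rewrite mulr0.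
  under [X in _ + X]eq_bigr do rewrite mulr0.
  rewrite !big1// addr0; apply=> [i|i mi].
    case: fm => [->|Lm]; first by have := fM (arrival m i); lra.
    by rewrite /f !clamp_low ?subrr//; have := LJ m i; lra.
  case: fm => [->|Lm]; first by have := fM (departure m i); lra.
  by rewrite /f !clamp_low ?subrr//; have := Ldn m i mi; lra.
(* Only arrivals raise f, each by at most J. *)
have fxi m : drift f m <= xi.
  have := @drift_le f m (fun=> J) (fun=> 0) (rate_ge0 m).
  rewrite -mulr_suml mulrC [X in _ + X]big1 ?addr0 => [h|i _]; last exact: mulr0.
  apply: le_trans Jnu; apply: h => [i|i mi].
    by have /andP[_] := clamp_lip _ _ (Lup m i); have := LJ m i; rewrite /f; lra.
  by have /andP[+ _] := clamp_lip _ _ (Ldn m i mi); rewrite /f; lra.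
(* Truncation at M only shortens upward jumps, and a downward jump of at most J <= xi stays above c,
   so f inherits the drift bound of L. *)
have fgam m : c + xi <= L m -> L m < M -> drift f m <= - gam.
  move=> cL LM; apply: le_trans (Ldrift m cL); apply: drift_le => [//|i|i mi].
    by have /andP[] := clamp_lip _ _ (Lup m i).
  by have := LdJ m i mi; have := Ldn m i mi => h1 h2; rewrite /f !clamp_id//; lra.
have pointwise m : (xi + gam) * (m \in s)%:R <=
    xi * (c - xi < L m)%R%:R - drift f m.
  have [ms|_] := boolP (m \in s).
    have := fgam m (sL _ ms) (sM _ ms); have := sL _ ms => h1 h2.
    by have [h|h] := ltP (c - xi) (L m); rewrite /=; lra.
  have [h|h] := ltP (c - xi) (L m); first by have := fxi m; rewrite /=; lra.
  by have := fconst m (or_intror h); rewrite /=; lra.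
rewrite -(sum_indicator_seq _ us0 us ss0) mulr_sumr.
apply: (@le_trans _ _ (\sum_(m <- s0) pi m * (xi * (c - xi < L m)%R%:R - drift f m))).
  by apply: ler_sum => m _; rewrite mulrCA ler_wpM2l.
under eq_bigr do rewrite mulrBr mulrCA.
rewrite sumrB -mulr_sumr lerBlDr; apply: ler_wpDr => //.
rewrite ler_wpM2l//.
rewrite (eq_bigr (fun m => if c - xi < L m then pi m else 0)); last first.
  by move=> m _; case: ifP; rewrite ?mulr1 ?mulr0.
rewrite -big_mkcond -big_filter/=; apply: cT; rewrite ?filter_uniq// => n.
by rewrite mem_filter => /andP[].
Qed.

(** Induction on levels: [level_crossing] at c compares the tail at c + xi with that at c - xi,
    hence the step 2 xi. The first comparison is with total mass 1, hence the exponent l + 1. *)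
Lemma stationary_geometric_tail (L : state nI -> R) (J xi gam B0 : R) :
  0 <= J -> J <= xi -> J * \sum_i nu i 0 <= xi -> 0 < xi -> 0 <= gam ->
  (forall m i, L m <= L (arrival m i)) ->
  (forall m i, L (arrival m i) <= L m + J) ->
  (forall m, B0 + xi <= L m -> drift L m <= - gam) ->
  (forall M, exists2 s, uniq s & forall n, L n < M -> n \in s) ->
  forall (l : nat) s, uniq s -> {in s, forall n, B0 + xi + 2 * xi * l%:R <= L n} ->
  \sum_(n <- s) pi n <= (xi / (xi + gam)) ^+ l.+1.
Proof.
move=> J0 Jxi Jnu xi0 gam0 Lup LJ Ldrift Lfin.
have xg : 0 < xi + gam by lra.
elim=> [|l IHl] s us sL.
  rewrite expr1 ler_pdivlMr// mulrC -[leRHS]mulr1.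
  apply: (@level_crossing L J xi gam B0) => //.
    by move=> s' us' _; exact: sum_stationary_le1.
  by move=> n /sL; rewrite mulr0 addr0.
rewrite exprS mulrAC ler_pdivlMr// [leLHS]mulrC.
apply: (@level_crossing L J xi gam (B0 + 2 * xi * l.+1%:R)) => //.
- move=> m cm; apply: Ldrift; apply: le_trans cm.
  by rewrite lerD2r lerDl !mulr_ge0// ltW.
- move=> s' us' s'L; apply: IHl => // n /s'L; rewrite -natr1 => h; lra.
- by move=> n /sL; rewrite addrAC.
Qed.

End Balance.

(** * The weighted (1 + a)-norm: growth, jumps and drift *)

Section Lyapunov.
Context {R : realType} {nI : nat}.
Variables (w : 'I_nI -> R) (a : R).
Hypotheses (w_ge1 : forall i, 1 <= w i) (a_gt0 : 0 < a).
Implicit Types (m n : state nI) (i : 'I_nI).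

Definition energy m : R := \sum_i w i * (m i)%:R `^ (1 + a).
Definition lyapunov m : R := energy m `^ (1 + a)^-1.

Let w_ge0 i : 0 <= w i. Proof. exact: le_trans (w_ge1 i). Qed.
Let p_ge1 : 1 <= 1 + a. Proof. by rewrite lerDl ltW. Qed.
Let p_gt0 : 0 < 1 + a. Proof. by have := a_gt0; lra. Qed.

Lemma energy_ge0 m : 0 <= energy m.
Proof. by apply: sumr_ge0 => i _; rewrite mulr_ge0 ?powR_ge0. Qed.

Lemma lyapunov_ge0 m : 0 <= lyapunov m. Proof. exact: powR_ge0. Qed.

Lemma lyapunov_gt0_energy m : 0 < lyapunov m -> 0 < energy m.
Proof.
move=> L0; rewrite lt_def energy_ge0 andbT; apply: contraTneq L0.
by rewrite /lyapunov => ->; rewrite powR0 ?ltxx// invr_eq0 gt_eqF.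
Qed.

Lemma coord_le_lyapunov m i : (m i)%:R <= lyapunov m.
Proof.
have -> : (m i)%:R = ((m i)%:R `^ (1 + a)) `^ (1 + a)^-1 :> R.
  by rewrite -powRrM divff ?gt_eqF// powRr1.
apply: ge0_ler_powR; rewrite ?invr_ge0 ?nnegrE ?powR_ge0 ?energy_ge0 ?(ltW p_gt0)//.
rewrite /energy (bigD1 i)//=; apply: ler_wpDr.
  by apply: sumr_ge0 => k _; rewrite mulr_ge0 ?powR_ge0.
by rewrite ler_peMl// powR_ge0.
Qed.

Lemma max_norm_le_lyapunov m : max_norm m <= lyapunov m.
Proof.
rewrite /max_norm; elim/big_ind: _ => [|x y xL yL|i _].
- exact: lyapunov_ge0.
- by rewrite /maxn; case: ifP.
- exact: coord_le_lyapunov.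
Qed.

(** States are integer valued: a nonzero one has a coordinate of at least 1. *)
Lemma lyapunov_ge1 m : 0 < lyapunov m -> 1 <= lyapunov m.
Proof.
move=> L0; have [i mi] : exists i, (0 < m i)%N.
  apply/existsP; apply: contraTT L0; rewrite negb_exists => /forallP m0.
  rewrite -leNgt /lyapunov /energy big1 ?powR0 ?invr_eq0 ?gt_eqF// => i _.
  by have := m0 i; rewrite lt0n negbK => /eqP ->; rewrite powR0 ?mulr0 ?gt_eqF.
by apply: le_trans (coord_le_lyapunov m i); rewrite ler1n.
Qed.

Lemma lyapunov_arrival_ge m i : lyapunov m <= lyapunov (arrival m i).
Proof.
apply: ge0_ler_powR; rewrite ?invr_ge0 ?nnegrE ?energy_ge0 ?(ltW p_gt0)//.
apply: ler_sum => k _; apply: ler_wpM2l => //.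
apply: ge0_ler_powR; rewrite ?nnegrE ?(ltW p_gt0)//.
by rewrite ffunE ler_nat leq_addr.
Qed.

(** Coordinates are dominated by [lyapunov], so a sublevel set lies in a box, enumerated by finite
    functions into ['I_N]. *)
Lemma lyapunov_sublevel_finite (M : R) :
  exists2 s : seq (state nI), uniq s & forall n, lyapunov n < M -> n \in s.
Proof.
pose N := (Num.truncn M).+1.
exists (undup [seq [ffun i => val (h i)] | h : {ffun 'I_nI -> 'I_N}]).
  exact: undup_uniq.
move=> n nM; rewrite mem_undup; apply/mapP.
have nN i : (n i < N)%N.
  rewrite -(ltr_nat R); apply: le_lt_trans (coord_le_lyapunov n i) _.
  by apply: lt_trans nM _; exact: truncnS_gt.
exists [ffun i => Ordinal (nN i)]; first exact: mem_enum.
by apply/ffunP => i; rewrite !ffunE.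
Qed.

(** Concavity of s^(1/(1+a)), whose slope at the energy of m is L^(-a)/(1+a) with L the value of
    [lyapunov] at m. *)
Lemma lyapunov_tangent m n : 0 < lyapunov m ->
  lyapunov n - lyapunov m <=
    lyapunov m `^ (- a) * ((energy n - energy m) / (1 + a)).
Proof.
move=> L0; have E0 := lyapunov_gt0_energy L0.
have p1 : (1 + a)^-1 <= 1 by rewrite invf_le1//; have := a_gt0; lra.
have pV0 : 0 < (1 + a)^-1 by rewrite invr_gt0.
have -> : lyapunov m `^ (- a) = energy m `^ ((1 + a)^-1 - 1).
  by rewrite /lyapunov -powRrM; congr (_ `^ _); field; rewrite gt_eqF.
have := powR_le_tangent pV0 p1 E0 (energy_ge0 n); rewrite -lerBlDl /lyapunov.
move: (_ `^ _) (_ `^ _) (_ `^ _) (energy n - _) => u v x d.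
by rewrite mulrAC mulrC [_^-1 * d]mulrC.
Qed.

(** Only coordinate i moves. The tangent of the convex power at the new value, evaluated at the old
    one, bounds the increment; [energy_departure] is the same with m i - 1. *)
Lemma energy_arrival m i :
  energy (arrival m i) - energy m <= (1 + a) * (w i * ((m i)%:R + 1) `^ a).
Proof.
rewrite /energy (bigD1 i)//= [X in _ - X](bigD1 i)//= opprD addrACA.
rewrite [X in _ + X <= _](_ : _ = 0); last first.
  apply/eqP; rewrite subr_eq0; apply/eqP; apply: eq_bigr => k ki.
  by rewrite ffunE (negbTE ki) addn0.
rewrite ffunE eqxx natrD addr0 -mulrBr mulrCA ler_wpM2l//.
have x1 : 0 <= (m i)%:R + 1 :> R by rewrite addr_ge0.
have := powR_ge_tangent p_ge1 x1 (ler0n R (m i)).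
rewrite [1 + a - 1]addrC addKr; lra.
Qed.

Lemma energy_departure m i : (0 < m i)%N ->
  energy (departure m i) - energy m <= - ((1 + a) * (w i * ((m i)%:R - 1) `^ a)).
Proof.
move=> mi; rewrite /energy (bigD1 i)//= [X in _ - X](bigD1 i)//= opprD addrACA.
rewrite [X in _ + X <= _](_ : _ = 0); last first.
  apply/eqP; rewrite subr_eq0; apply/eqP; apply: eq_bigr => k ki.
  by rewrite ffunE (negbTE ki) subn0.
rewrite ffunE eqxx natrB// addr0 -mulrBr mulrCA -mulrN ler_wpM2l//.
have x1 : 0 <= (m i)%:R - 1 :> R by rewrite subr_ge0 ler1n.
have := powR_ge_tangent p_ge1 x1 (ler0n R (m i)).
rewrite [1 + a - 1]addrC addKr; lra.
Qed.

(** Away from the empty state m i + 1 is at most twice L, so the factor L^(-a) of the tangent bound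
    cancels the growth of the energy increment. *)
Lemma lyapunov_arrival_le m i :
  lyapunov (arrival m i) <= lyapunov m + 2 `^ a * \sum_k w k.
Proof.
have wi : w i <= \sum_k w k by rewrite (bigD1 i)//= lerDl sumr_ge0.
have := lyapunov_ge0 m; rewrite le_eqVlt => /predU1P[L0|L0]; last first.
  have L1 := lyapunov_ge1 L0; have miL := coord_le_lyapunov m i.
  rewrite -lerBlDl; apply: le_trans (lyapunov_tangent _ L0) _.
  apply: (@le_trans _ _ (lyapunov m `^ (- a) * (w i * (2 * lyapunov m) `^ a))).
    rewrite ler_wpM2l ?powR_ge0// ler_pdivrMr// [leRHS]mulrC.
    apply: le_trans (energy_arrival m i) _.
    rewrite ler_wpM2l ?(ltW p_gt0)// ler_wpM2l//.
    by apply: ge0_ler_powR; rewrite ?nnegrE ?(ltW a_gt0)//; lra.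
  rewrite powRM ?(ltW L0)// powRN.
  have z0 : lyapunov m `^ a != 0 by apply: lt0r_neq0; exact: powR_gt0.
  rewrite [leLHS](_ : _ = 2 `^ a * w i); last first.
    by rewrite mulrCA [X in _ * X]mulrCA mulVf// mulr1 mulrC.
  by rewrite ler_wpM2l ?powR_ge0.
(* No tangent is available at the empty state; there the new value is w_i^(1/(1+a)), at most w_i
   because w_i >= 1. *)
have m0 k : m k = 0%N.
  by apply/eqP; rewrite -leqn0 -(ler_nat R) mulr0n L0 coord_le_lyapunov.
rewrite -L0 add0r /lyapunov /energy (bigD1 i)//= big1 ?addr0; last first.
  by move=> k ki; rewrite ffunE (negbTE ki) m0 powR0 ?mulr0// gt_eqF.
rewrite ffunE eqxx m0 powR1 mulr1.
apply: (@le_trans _ _ (w i)).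
  by rewrite ler1_powR// invf_le1//; have := a_gt0; lra.
apply: le_trans wi _; rewrite ler_peMl ?sumr_ge0//.
by rewrite -[leLHS](powRr0 2) ler_powR// ?ler1n// ltW.
Qed.

(** The term of a largest coordinate i suffices: the energy is at most the total weight times (m
    i)^(1+a), and nu_i times the sum of inverse rates is at least 1. *)
Lemma lyapunov_powR_le (nu : 'I_nI -> R) m : (forall i, 0 < nu i) ->
  ((\sum_i (nu i)^-1) * \sum_i w i)^-1 * lyapunov m `^ a <=
  \sum_i w i * nu i * (m i)%:R `^ a.
Proof.
move=> nu0; set wsum := \sum_i w i; set Z := \sum_i (nu i)^-1.
(* Without routes all sums are 0 and the inverse of 0 is 0, so both sides vanish. *)
have [nI0|nI_gt0] := posnP nI.
  have no (f : 'I_nI -> R) : \sum_i f i = 0.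
    by rewrite big1// => i; have := ltn_ord i; rewrite {2}nI0.
  by rewrite /Z !no mul0r invr0 mul0r.
pose i := [arg max_(k > Ordinal nI_gt0) m k]%N.
have maxi k : (m k <= m i)%N by rewrite /i; case: arg_maxnP => // j _; exact.
have nui : (nu i)^-1 <= Z.
  by rewrite /Z (bigD1 i)//= lerDl sumr_ge0// => k _; rewrite invr_ge0 ltW.
have Z0 : 0 < Z by apply: lt_le_trans nui; rewrite invr_gt0.
have w1 : 1 <= wsum.
  by apply: le_trans (w_ge1 i) _; rewrite /wsum (bigD1 i)//= lerDl sumr_ge0.
have w0 : 0 < wsum by exact: lt_le_trans w1.
have EM : energy m <= wsum * (m i)%:R `^ (1 + a).
  rewrite /energy /wsum mulr_suml; apply: ler_sum => k _; apply: ler_wpM2l => //.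
  by apply: ge0_ler_powR; rewrite ?nnegrE ?(ltW p_gt0)// ler_nat.
have La : lyapunov m `^ a <= wsum * (m i)%:R `^ a.
  have q0 : 0 <= (1 + a)^-1 * a by rewrite mulr_ge0 ?invr_ge0 ?(ltW p_gt0) ?(ltW a_gt0).
  apply: (@le_trans _ _ ((wsum * (m i)%:R `^ (1 + a)) `^ ((1 + a)^-1 * a))).
    rewrite /lyapunov -powRrM; apply: ge0_ler_powR => //.
      by rewrite nnegrE energy_ge0.
    by rewrite nnegrE mulr_ge0 ?powR_ge0 ?(ltW w0).
  rewrite powRM ?powR_ge0 ?(ltW w0)// -powRrM mulVKf ?(lt0r_neq0 p_gt0)//.
  rewrite ler_wpM2r ?powR_ge0// ler1_powR// mulrC ler_pdivrMr// mul1r.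
  by rewrite lerDr.
rewrite mulrC ler_pdivrMr ?mulr_gt0//.
apply: (le_trans La); rewrite [leLHS]mulrC mulrA ler_wpM2r ?(ltW w0)//.
apply: (@le_trans _ _ (nu i * (m i)%:R `^ a * Z)).
  rewrite mulrAC ler_peMl ?powR_ge0// -ler_pdivrMl ?nu0// mulr1.
  exact: nui.
rewrite ler_wpM2r ?(ltW Z0)// (bigD1 i)//=; apply: ler_wpDr.
  by apply: sumr_ge0 => k _; rewrite !mulr_ge0 ?powR_ge0// ltW.
by rewrite -mulrA ler_peMl// mulr_ge0 ?powR_ge0// ltW.
Qed.

(** The increment bound of [powR_succ_le] at M = 2z, which covers m i + 1 as soon as m i <= z and 1
    <= z. *)
Definition error_term (z : R) := if 1 <= a then a * (2 * z) `^ (a - 1) else 1.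

(** The energy bounds involve powers at m i + 1 and m i - 1; replacing both by powers at m i costs
    [error_term] per jump. What remains is the fluid drift, controlled by the hypothesis on eps. *)
Lemma lyapunov_drift_le (mu nu : 'cV[R]_nI) (Lambda : 'cV[R]_nI -> 'cV[R]_nI)
    (eps c : R) m :
  (forall i, 0 <= nu i 0) -> (forall i, 0 <= departure_rate mu Lambda m i <= mu i 0 * c) ->
  eps * (\sum_i w i * nu i 0 * (m i)%:R `^ a) <=
    \sum_i w i * (m i)%:R `^ a * (departure_rate mu Lambda m i - nu i 0) ->
  0 < lyapunov m ->
  drift mu nu Lambda lyapunov m <= lyapunov m `^ (- a) *
    (error_term (lyapunov m) * (\sum_i w i * (nu i 0 + mu i 0 * c)) -
     eps * (\sum_i w i * nu i 0 * (m i)%:R `^ a)).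
Proof.
move=> nu0 rate policy L0; set r := departure_rate mu Lambda m.
set z := lyapunov m; set e := error_term z.
have L1 : 1 <= z := lyapunov_ge1 L0.
have miz i : (m i)%:R <= z := coord_le_lyapunov m i.
have r0 i : 0 <= r i by have /andP[] := rate i.
have e0 : 0 <= e by rewrite /e /error_term; case: ifP => // _; rewrite mulr_ge0 ?powR_ge0 ?ltW.
have stepup i : ((m i)%:R + 1) `^ a <= (m i)%:R `^ a + e.
  by apply: powR_succ_le => //; have := miz i; lra.
have stepdown i : (0 < m i)%N -> (m i)%:R `^ a <= ((m i)%:R - 1) `^ a + e.
  move=> mi; rewrite -[X in X `^ a <= _](subrK 1); apply: powR_succ_le => //.
    by rewrite subr_ge0 ler1n.
  by have := miz i; lra.
apply: (@le_trans _ _ (z `^ (- a) *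
    (\sum_i nu i 0 * (w i * ((m i)%:R `^ a + e)) +
     \sum_i r i * (w i * (e - (m i)%:R `^ a))))).
  rewrite mulrDr !mulr_sumr.
  under eq_bigr do rewrite mulrCA.
  under [X in _ + X]eq_bigr do rewrite mulrCA.
  apply: drift_le => // [i|i mi].
    apply: le_trans (lyapunov_tangent _ L0) _; rewrite ler_wpM2l ?powR_ge0//.
    rewrite ler_pdivrMr// [leRHS]mulrC; apply: le_trans (energy_arrival m i) _.
    by rewrite ler_wpM2l ?(ltW p_gt0)// ler_wpM2l.
  apply: le_trans (lyapunov_tangent _ L0) _; rewrite ler_wpM2l ?powR_ge0//.
  rewrite ler_pdivrMr// [leRHS]mulrC; apply: le_trans (energy_departure mi) _.
  rewrite -mulrN ler_wpM2l ?(ltW p_gt0)// -mulrN ler_wpM2l//.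
  by have := stepdown i mi; lra.
rewrite ler_wpM2l ?powR_ge0//.
apply: (@le_trans _ _ (e * (\sum_i w i * (nu i 0 + r i)) -
    \sum_i w i * (m i)%:R `^ a * (r i - nu i 0))).
  rewrite mulr_sumr -big_split -sumrB/= le_eqVlt; apply/orP; left; apply/eqP.
  by apply: eq_bigr => i _; ring.
apply: lerB => //; rewrite ler_wpM2l//; apply: ler_sum => i _.
by rewrite ler_wpM2l// lerD2l; have /andP[] := rate i.
Qed.


End Lyapunov.

(** * The gap, and first-order optimality of the fair allocation *)

Section FairPolicy.
Context {R : realType} {nJ nI : nat}.
Variables (route : 'I_nI -> {set 'I_nJ}) (C : 'cV[R]_nJ) (kappa : 'cV[R]_nI).
Variable alpha : R.
Hypotheses (C_gt0 : positive_cv C) (kappa_gt0 : positive_cv kappa).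
Hypotheses (route_neq0 : forall i, route i != finset.set0) (alpha_gt0 : 0 < alpha).
Local Notation A := (@routing_mx R nJ nI route).
Local Notation Ctot := (\sum_j C j 0).

Let A_ge0 j i : 0 <= A j i. Proof. by rewrite mxE. Qed.

Lemma routing_mx_le (v : 'cV[R]_nI) i j : (forall k, 0 <= v k 0) ->
  j \in route i -> v i 0 <= (A *m v) j 0.
Proof.
move=> v0 ji; rewrite mxE (bigD1 i)//= mxE ji mul1r lerDl.
by apply: sumr_ge0 => k _; rewrite mulr_ge0.
Qed.

Lemma capacity_le_total j : C j 0 <= Ctot.
Proof. by rewrite (bigD1 j)//= lerDl sumr_ge0// => k _; rewrite ltW. Qed.

(** The capacity constraints are closed and monotone in e, so they pass to the supremum once its set
    is known to be nonempty and bounded. *)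
Lemma gap_bounds (rho : 'cV[R]_nI) : (0 < nI)%N -> positive_cv rho ->
  strictly_subcritical A C rho ->
  0 < gap A C rho /\
  forall j, (1 + gap A C rho) * (A *m rho) j 0 <= C j 0.
Proof.
move=> nI_gt0 rho0 sub; pose x j := (A *m rho) j 0.
have rho_ge0 i : 0 <= rho i 0 by exact: ltW.
have x0 j : 0 <= x j by rewrite /x mxE sumr_ge0// => i _; rewrite mulr_ge0.
have xC j : 0 < C j 0 - x j by rewrite subr_gt0; exact: sub.
pose S := [set e : R | 0 < e /\ forall j, ((1 + e) *: (A *m rho)) j 0 <= C j 0].
(* The ratio x_j / (C_j - x_j) is the inverse of the slack factor of resource j; 1/(y + 1) lies
   below all slack factors and stays positive even when y = 0. *)
pose y := \sum_j x j / (C j 0 - x j).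
have yj j : x j / (C j 0 - x j) <= y.
  by rewrite /y (bigD1 j)//= lerDl sumr_ge0// => k _; rewrite divr_ge0// ltW.
have y0 : 0 <= y by apply: sumr_ge0 => j _; rewrite divr_ge0// ltW.
have y1 : 0 < y + 1 by rewrite ltr_wpDl.
have SE e j : ((1 + e) *: (A *m rho)) j 0 = x j + e * x j.
  by rewrite mxE mulrDl mul1r.
have Se : S (y + 1)^-1.
  split=> [|j]; first by rewrite invr_gt0.
  rewrite SE addrC -lerBrDr mulrC ler_pdivrMr// mulrC -ler_pdivrMr//.
  by rewrite ler_wpDr.
have Sub e j : S e -> e * x j <= C j 0 - x j.
  by move=> [_ /(_ j)]; rewrite SE addrC -lerBrDr.
(* A resource on some route carries positive load, which bounds the admissible e. *)
pose i0 := Ordinal nI_gt0.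
have [j0 j0i0] : exists j, j \in route i0 by apply/set0Pn.
have x_gt0 : 0 < x j0 by apply: lt_le_trans (routing_mx_le rho_ge0 j0i0).
have ubS : ubound S (C j0 0 / x j0).
  move=> e Se'; rewrite ler_pdivlMr//; apply: le_trans (Sub e j0 Se') _.
  by rewrite gerBl.
have supS : has_ubound S by exists (C j0 0 / x j0).
split.
- by apply: lt_le_trans (ub_le_sup supS Se); rewrite invr_gt0.
- move=> j; rewrite -/(x j); have := x0 j; rewrite le_eqVlt => /predU1P[<-|xj0].
    by rewrite mulr0 ltW.
  rewrite mulrDl mul1r addrC -lerBrDr -ler_pdivlMr//.
  apply: ge_sup; first by exists (y + 1)^-1.
  by move=> e Se'; rewrite ler_pdivlMr//; exact: Sub.
Qed.

Section Allocation.
Variables (n L : 'cV[R]_nI).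
Hypotheses (n_ge0 : forall i, 0 <= n i 0)
  (fair : is_fair_allocation A C kappa alpha n L).

Lemma fair_allocation_ge0 i : 0 <= L i 0.
Proof.
have [L0 [Lge0 _] _] := fair.
by have [/Lge0//|/L0->] := boolP (0 < n i 0).
Qed.

Lemma fair_allocation_le_total i : L i 0 <= Ctot.
Proof.
have [L0 [Lge0 LC] _] := fair.
have [ni|/L0->] := boolP (0 < n i 0); last by apply: sumr_ge0 => j _; exact: ltW.
have [j ji] : exists j, j \in route i by apply/set0Pn.
apply: le_trans (capacity_le_total j); apply: le_trans (LC j).
rewrite (bigD1 i)//= mxE ji mul1r lerDl sumr_ge0// => k /andP[nk _].
by rewrite mulr_ge0// Lge0.
Qed.

(* The utility is concave, so its linearization at a feasible positive y
   increases from y to the maximizer L. *)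
Lemma fair_allocation_supergradient (y : 'cV[R]_nI) : positive_cv y ->
  (forall j, (A *m y) j 0 <= C j 0) ->
  0 <= \sum_i kappa i 0 * n i 0 `^ alpha * (y i 0 `^ (- alpha) * (L i 0 - y i 0)).
Proof.
move=> y0 yC; have [_ _ Lmax] := fair.
pose U (x : R) := if alpha == 1 then ln x else x `^ (1 - alpha) / (1 - alpha).
have tangent i := fair_utility_le_tangent alpha_gt0 (fair_allocation_ge0 i) (y0 i).
have feasible_y : feasible A C n y.
  split=> [i _|j]; first exact: ltW.
  apply: le_trans (yC j); rewrite mxE [leRHS](bigID (fun i => 0 < n i 0))/= lerDl.
  by apply: sumr_ge0 => i _; rewrite mulr_ge0// ltW.
have objy : fair_objective kappa alpha n y =
    (\sum_(i | 0 < n i 0) kappa i 0 * n i 0 `^ alpha * U (y i 0))%:E.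
  rewrite -sumEFin; apply: eq_bigr => i _.
  by rewrite (tangent i).1 -EFinM.
have objL : (fair_objective kappa alpha n L <= (\sum_(i | (0 < n i 0)%R)
    kappa i 0 * n i 0 `^ alpha *
      (U (y i 0) + y i 0 `^ (- alpha) * (L i 0 - y i 0)))%:E)%E.
  rewrite -sumEFin; apply: lee_sum => i ni; rewrite [leRHS]EFinM.
  apply: lee_wpmul2l; last exact: (tangent i).2.
  by rewrite lee_fin mulr_ge0 ?powR_ge0// ltW.
have := le_trans (Lmax y feasible_y) objL.
rewrite objy lee_fin -subr_ge0 -sumrB => h.
(* Outside I_+(n) the weight n_i^alpha is 0, so the sum may run over all routes. *)
rewrite (bigID (fun i => 0 < n i 0))/= [X in _ + X]big1 ?addr0 => [|i ni].
  apply: (le_trans h); rewrite le_eqVlt; apply/orP; left; apply/eqP.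
  by apply: eq_bigr => i _; ring.
have -> : n i 0 = 0 by apply/eqP; rewrite eq_le n_ge0 leNgt ni.
by rewrite powR0 ?gt_eqF// mulr0 mul0r.
Qed.

End Allocation.
End FairPolicy.

(** Each summand of the numerator serves one regime. For a >= 1 the left side is of order 1/z and
    the first summand over eps suffices; for a < 1 it is of order z^(-a) and the second summand over
    eps^(1/a) suffices, the minimum being at most eps^(1/a). *)
Lemma error_term_le {R : realType} (a D c eps z : R) :
  0 < a -> 0 < D -> 0 < c -> 0 < eps -> 0 < z ->
  (if 1 <= a then (a * 2 `^ a * D / c + (2 * D / c) `^ a^-1) / eps
   else (a * 2 `^ a * D / c + (2 * D / c) `^ a^-1) / Num.min (eps `^ a^-1) eps) <= z ->
  z `^ (- a) * (error_term a z * D) <= eps * (c / 2).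
Proof.
move=> a0 D0 c0 e0 z0; rewrite /error_term.
have x0 : 0 < 2 * D / c by rewrite divr_gt0// mulr_gt0.
have y0 : 0 < (2 * D / c) `^ a^-1 by exact: powR_gt0.
have u0 : 0 < a * 2 `^ a * D / c by rewrite divr_gt0// !mulr_gt0// powR_gt0.
case: ifPn => [a1|_] Bz.
  have : a * 2 `^ a * D / c / eps <= z.
    apply: le_trans Bz; rewrite ler_pM2r ?invr_gt0// lerDl; exact: ltW.
  rewrite !ler_pdivrMr// => h.
  have two : 2 `^ a = 2 * 2 `^ (a - 1) :> R by rewrite mulr_powRB1.
  have zz : z `^ (- a) * z `^ (a - 1) = z^-1.
    by rewrite -powRD ?(gt_eqF z0) ?implybT// -powR_inv1 ?ltW//; congr (_ `^ _); ring.
  rewrite powRM ?(ltW z0)//.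
  rewrite [leLHS](_ : _ = a * 2 `^ (a - 1) * D * (z `^ (- a) * z `^ (a - 1))); last by ring.
  rewrite zz ler_pdivrMr//; move: h; rewrite two; lra.
have m0 : 0 < Num.min (eps `^ a^-1) eps by rewrite lt_min powR_gt0.
have : (2 * D / c) `^ a^-1 / eps `^ a^-1 <= z.
  apply: le_trans Bz; apply: ler_pM; rewrite ?invr_ge0 ?powR_ge0//.
    by rewrite lerDr ltW.
  by rewrite lef_pV2 ?posrE ?powR_gt0// ge_min lexx.
rewrite ler_pdivrMr ?powR_gt0// => h.
have aV x : 0 <= x -> (x `^ a^-1) `^ a = x.
  by move=> x_ge0; rewrite -powRrM mulVf ?gt_eqF// powRr1.
have ep0 : 0 <= eps `^ a^-1 by exact: powR_ge0.
have h2 : ((2 * D / c) `^ a^-1) `^ a <= (z * eps `^ a^-1) `^ a.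
  by apply: ge0_ler_powR; rewrite ?nnegrE ?mulr_ge0 ?powR_ge0// ltW.
have := h2; rewrite (powRM _ (ltW z0) ep0) !aV; [|exact: ltW..].
rewrite ler_pdivrMr// powRN mul1r ler_pdivrMl ?powR_gt0//; lra.
Qed.

(** * Closure properties of positive continuous functions of the load *)

Section LoadDependence.
Context {R : realType} {nI : nat}.
Local Notation V := ('cV[R]_nI).
Implicit Types f g : V -> V -> R.

(* Continuity at each point of the open positive cone, rather than within it. *)
Definition load_continuous f :=
  (forall mu nu : V, positive_cv mu -> positive_cv nu -> 0 < f mu nu) /\
  forall p : V * V, positive_cv p.1 -> positive_cv p.2 ->
    {for p, continuous (fun q => f q.1 q.2)}.

Lemma load_continuous_dependent f : load_continuous f -> load_dependent f.
Proof.
move=> [f0 fc]; split=> //; apply: continuous_in_subspaceT => p.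
by rewrite inE => -[]; exact: fc.
Qed.

Lemma load_continuous_cst (c : R) : 0 < c -> load_continuous (fun _ _ => c).
Proof. by move=> c0; split=> // p _ _; exact: cvg_cst. Qed.

Lemma load_continuous_mu i : load_continuous (fun mu _ => mu i 0).
Proof.
split=> [mu nu mu0 _|p _ _]; first exact: mu0.
apply: (@continuous_comp _ _ _ fst (fun v : V => v i 0)); first exact: cvg_fst.
exact: coord_continuous.
Qed.

Lemma load_continuous_nu i : load_continuous (fun _ nu => nu i 0).
Proof.
split=> [mu nu _ nu0|p _ _]; first exact: nu0.
apply: (@continuous_comp _ _ _ snd (fun v : V => v i 0)); first exact: cvg_snd.
exact: coord_continuous.
Qed.

Lemma load_continuousD f g : load_continuous f -> load_continuous g ->
  load_continuous (fun mu nu => f mu nu + g mu nu).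
Proof.
move=> [f0 fc] [g0 gc]; split=> [mu nu hm hn|p hm hn].
  by rewrite addr_gt0 ?f0 ?g0.
by apply: continuousD; [exact: fc|exact: gc].
Qed.

Lemma load_continuousM f g : load_continuous f -> load_continuous g ->
  load_continuous (fun mu nu => f mu nu * g mu nu).
Proof.
move=> [f0 fc] [g0 gc]; split=> [mu nu hm hn|p hm hn].
  by rewrite mulr_gt0 ?f0 ?g0.
by apply: continuousM; [exact: fc|exact: gc].
Qed.

Lemma load_continuousV f : load_continuous f ->
  load_continuous (fun mu nu => (f mu nu)^-1).
Proof.
move=> [f0 fc]; split=> [mu nu hm hn|p hm hn]; first by rewrite invr_gt0 f0.
by apply: continuousV; [rewrite gt_eqF ?f0|exact: fc].
Qed.

Lemma load_continuous_powR f (r : R) : load_continuous f ->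
  load_continuous (fun mu nu => f mu nu `^ r).
Proof.
move=> [f0 fc]; split=> [mu nu hm hn|p hm hn]; first by rewrite powR_gt0 ?f0.
apply: (@continuous_comp _ _ _ (fun q => f q.1 q.2) (fun x => x `^ r)).
  exact: fc.
apply: differentiable_continuous; apply/derivable1_diffP.
by apply: derivable_powR; rewrite in_itv/= f0.
Qed.

Lemma load_continuous_sum (F : 'I_nI -> V -> V -> R) : (0 < nI)%N ->
  (forall i, load_continuous (F i)) ->
  load_continuous (fun mu nu => \sum_i F i mu nu).
Proof.
move=> nI0 Fc; split=> [mu nu hm hn|p hm hn].
  rewrite (bigD1 (Ordinal nI0))//= ltr_wpDr ?(Fc _).1// sumr_ge0// => i _.
  exact/ltW/(Fc i).1.
apply: cvg_big => [|i _]; first exact: add_continuous.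
exact: (Fc i).2.
Qed.

End LoadDependence.

(** * The explicit constants and their load dependence *)

Section Constants.
Context {R : realType} {nJ nI : nat}.
Variables (C : 'cV[R]_nJ) (kappa : 'cV[R]_nI) (alpha : R).
Implicit Types mu nu : 'cV[R]_nI.

(* [raw_weight i * mu i] is the i-th partial derivative of the fair objective at
   rho, up to the factor [n_i `^ alpha]. *)
Definition raw_weight i mu nu : R :=
  kappa i 0 * (nu i 0 / mu i 0) `^ (- alpha) / mu i 0.
(* Rescaled so that every weight is at least 1, for the Lyapunov function to
   dominate the max norm. *)
Definition weight i mu nu : R :=
  raw_weight i mu nu * \sum_k (raw_weight k mu nu)^-1.
Definition weight_sum mu nu : R := \sum_i weight i mu nu.
Definition jump_bound mu nu : R := 2 `^ alpha * weight_sum mu nu.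
(** The factor makes it dominate both the largest jump and the largest upward drift, as
    [level_crossing] requires. *)
Definition xi_const mu nu : R := jump_bound mu nu * (1 + \sum_i nu i 0).
Definition norm_const mu nu : R :=
  ((\sum_i (nu i 0)^-1) * weight_sum mu nu)^-1.
(** The other half of [norm_const] absorbs the error term. *)
Definition K_const mu nu : R := norm_const mu nu / 2.
(** The factor of [error_term] in [lyapunov_drift_le], with total capacity bounding every
    allocation. *)
Definition rate_sum mu nu : R :=
  \sum_i weight i mu nu * (nu i 0 + mu i 0 * \sum_j C j 0).
Definition K'_const mu nu : R :=
  alpha * 2 `^ alpha * rate_sum mu nu / norm_const mu nu +
  (2 * rate_sum mu nu / norm_const mu nu) `^ alpha^-1.

Hypotheses (nI_gt0 : (0 < nI)%N) (alpha_gt0 : 0 < alpha).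
Hypotheses (kappa_gt0 : positive_cv kappa) (C_gt0 : 0 < \sum_j C j 0).

Lemma load_continuous_weight i : load_continuous (weight i).
Proof.
have raw k : load_continuous (raw_weight k).
  apply: load_continuousM; last exact/load_continuousV/load_continuous_mu.
  apply: load_continuousM; first exact: load_continuous_cst.
  apply: load_continuous_powR; apply: load_continuousM.
    exact: load_continuous_nu.
  exact/load_continuousV/load_continuous_mu.
apply: load_continuousM => //; apply: load_continuous_sum => // k.
exact: load_continuousV.
Qed.

Lemma load_continuous_weight_sum : load_continuous weight_sum.
Proof. by apply: load_continuous_sum => // i; exact: load_continuous_weight. Qed.

Lemma load_continuous_jump : load_continuous jump_bound.
Proof.
apply: load_continuousM; last exact: load_continuous_weight_sum.
by apply: load_continuous_cst; exact: powR_gt0.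
Qed.

Lemma load_continuous_xi : load_continuous xi_const.
Proof.
apply: load_continuousM; first exact: load_continuous_jump.
apply: load_continuousD; first exact: load_continuous_cst.
by apply: load_continuous_sum => // i; exact: load_continuous_nu.
Qed.

Lemma load_continuous_norm_const : load_continuous norm_const.
Proof.
apply: load_continuousV; apply: load_continuousM.
  apply: load_continuous_sum => // i.
  exact/load_continuousV/load_continuous_nu.
exact: load_continuous_weight_sum.
Qed.

Lemma load_continuous_K : load_continuous K_const.
Proof.
apply: load_continuousM; first exact: load_continuous_norm_const.
exact: load_continuous_cst.
Qed.

Lemma load_continuous_rate_sum : load_continuous rate_sum.
Proof.
apply: load_continuous_sum => // i; apply: load_continuousM.
  exact: load_continuous_weight.
apply: load_continuousD; first exact: load_continuous_nu.
apply: load_continuousM; first exact: load_continuous_mu.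
exact: load_continuous_cst.
Qed.

Lemma load_continuous_K' : load_continuous K'_const.
Proof.
have D := load_continuous_rate_sum.
have cV := load_continuousV load_continuous_norm_const.
apply: load_continuousD.
  apply: load_continuousM => //; apply: load_continuousM => //.
  by apply: load_continuous_cst; rewrite mulr_gt0// powR_gt0.
apply: load_continuous_powR; apply: load_continuousM => //.
by apply: load_continuousM => //; exact: load_continuous_cst.
Qed.

Lemma weight_ge1 mu nu i : positive_cv mu -> positive_cv nu ->
  1 <= weight i mu nu.
Proof.
move=> mu0 nu0; have raw0 k : 0 < raw_weight k mu nu.
  by rewrite divr_gt0// mulr_gt0// powR_gt0// divr_gt0.
rewrite -ler_pdivrMl// mulr1 (bigD1 i)//= lerDl sumr_ge0// => k _.
by rewrite invr_ge0 ltW.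
Qed.

End Constants.

(** * Negative drift under the fair policy *)

Section FairDrift.
Context {R : realType} {nJ nI : nat}.
Variables (route : 'I_nI -> {set 'I_nJ}) (C : 'cV[R]_nJ) (kappa : 'cV[R]_nI).
Variable alpha : R.
Hypotheses (C_gt0 : positive_cv C) (kappa_gt0 : positive_cv kappa).
Hypotheses (route_neq0 : forall i, route i != finset.set0) (alpha_gt0 : 0 < alpha).
Hypothesis nI_gt0 : (0 < nI)%N.
Local Notation A := (@routing_mx R nJ nI route).
Local Notation Ctot := (\sum_j C j 0).

Variables (mu nu : 'cV[R]_nI) (Lambda : 'cV[R]_nI -> 'cV[R]_nI).
Hypotheses (mu_gt0 : positive_cv mu) (nu_gt0 : positive_cv nu)
  (fair : is_fair_policy A C kappa alpha Lambda).
Local Notation rate := (departure_rate mu Lambda).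
Local Notation w i := (weight kappa alpha i mu nu).

Let fair_at (m : state nI) :
  is_fair_allocation A C kappa alpha (real_state m) (Lambda (real_state m)).
Proof. by apply: fair => i; rewrite mxE. Qed.

Lemma fair_rate_bounds (m : state nI) i : 0 <= rate m i <= mu i 0 * Ctot.
Proof.
have mu0 := ltW (mu_gt0 i).
have Ct0 : 0 <= Ctot by apply: sumr_ge0 => j _; exact: ltW.
rewrite /departure_rate; case: ifP => _; last by rewrite lexx mulr_ge0.
rewrite mulr_ge0// ?(fair_allocation_ge0 (fair_at m))//= ler_wpM2l//.
exact: (fair_allocation_le_total C_gt0 route_neq0 (fair_at m)).
Qed.

(** The supergradient inequality is taken at y = (1 + eps) rho, feasible by hypothesis. Up to (1 +
    eps)^(-alpha) its coefficients are [raw_weight] times mu_i, and mu_i y_i = (1 + eps) nu_i. *)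
Lemma fair_policy_drift (m : state nI) (eps : R) : 0 <= eps ->
  (forall j, (1 + eps) * (A *m traffic mu nu) j 0 <= C j 0) ->
  eps * (\sum_i w i * nu i 0 * (m i)%:R `^ alpha) <=
  \sum_i w i * (m i)%:R `^ alpha * (rate m i - nu i 0).
Proof.
move=> e0 eC; have e1 : 0 < 1 + eps by rewrite ltr_pwDl.
have rho0 i : 0 < nu i 0 / mu i 0 by rewrite divr_gt0.
pose y : 'cV[R]_nI := (1 + eps) *: traffic mu nu.
have y0 : positive_cv y by move=> i; rewrite !mxE mulr_gt0.
have yC j : (A *m y) j 0 <= C j 0 by rewrite /y -scalemxAr mxE.
have n0 i : 0 <= real_state m i 0 :> R by rewrite mxE.
have := fair_allocation_supergradient kappa_gt0 alpha_gt0 n0 (fair_at m) y0 yC.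
pose W := \sum_k (raw_weight kappa alpha k mu nu)^-1.
have W0 : 0 <= W.
  apply: sumr_ge0 => k _.
  by rewrite invr_ge0 !mulr_ge0 ?powR_ge0 ?invr_ge0// ltW.
(* This factor removes (1 + eps)^(-alpha) and turns [raw_weight] into [weight]. *)
have z0 : 0 <= W * (1 + eps) `^ alpha by rewrite mulr_ge0 ?powR_ge0.
rewrite -[in X in _ -> X]subr_ge0 [in X in _ -> X]mulr_sumr -sumrB.
move=> /(mulr_ge0 z0) h; apply: (le_trans h); rewrite mulr_sumr le_eqVlt; apply/orP; left; apply/eqP.
apply: eq_bigr => i _; rewrite !mxE powRM ?(ltW e1) ?(ltW (rho0 i))//.
rewrite /weight -/W /raw_weight [(1 + eps) `^ (- _)]powRN /departure_rate.
have ep0 : (1 + eps) `^ alpha != 0 by apply: lt0r_neq0; exact: powR_gt0.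
have mu0 : mu i 0 != 0 by rewrite gt_eqF.
case: (posnP (m i)) => [->|_].
  by rewrite !powR0 ?gt_eqF// !(mulr0, mul0r) subr0.
by field; rewrite ep0 mu0.
Qed.

(** The leading term is at most -eps times [norm_const], since L^(-alpha) cancels L^alpha; beyond
    the threshold the error uses up at most half of it. *)
Lemma fair_lyapunov_drift (m : state nI) (eps : R) : 0 < eps ->
  (forall j, (1 + eps) * (A *m traffic mu nu) j 0 <= C j 0) ->
  (if 1 <= alpha then K'_const C kappa alpha mu nu / eps
   else K'_const C kappa alpha mu nu / Num.min (eps `^ alpha^-1) eps) <=
    lyapunov (fun i => w i) alpha m ->
  0 < lyapunov (fun i => w i) alpha m ->
  drift mu nu Lambda (lyapunov (fun i => w i) alpha) m <=
    - (eps * K_const kappa alpha mu nu).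
Proof.
move=> e0 eC BL L0.
have w1 i : 1 <= w i by exact: weight_ge1.
have nu0 i : 0 <= nu i 0 by exact: ltW.
have Ct0 : 0 < Ctot.
  have [j _] : exists j, j \in route (Ordinal nI_gt0) by apply/set0Pn.
  exact: lt_le_trans (capacity_le_total C_gt0 j).
have := lyapunov_drift_le w1 alpha_gt0 nu0 (fair_rate_bounds m)
  (fair_policy_drift m (ltW e0) eC) L0.
have := lyapunov_powR_le w1 alpha_gt0 m nu_gt0.
have [D0 _] := load_continuous_rate_sum alpha nI_gt0 kappa_gt0 Ct0.
have [c0 _] := load_continuous_norm_const alpha nI_gt0 kappa_gt0.
have := error_term_le alpha_gt0 (D0 _ _ mu_gt0 nu_gt0) (c0 _ _ mu_gt0 nu_gt0) e0 L0 BL.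
rewrite -/(rate_sum C kappa alpha mu nu) /K_const -/(weight_sum kappa alpha mu nu).
rewrite -/(norm_const kappa alpha mu nu).
set z := lyapunov _ _ m; set E := error_term _ _; set D := rate_sum _ _ _ _ _.
set c := norm_const _ _ _ _; set S := \sum_i _ * _ * _ => hE hS hd.
apply: (le_trans hd); rewrite mulrBr.
have zz : z `^ (- alpha) * z `^ alpha = 1.
  by rewrite powRN mulVf// gt_eqF// powR_gt0.
have : z `^ (- alpha) * (eps * (c * z `^ alpha)) <= z `^ (- alpha) * (eps * S).
  by rewrite ler_wpM2l ?powR_ge0// ler_wpM2l// ltW.
have -> : z `^ (- alpha) * (eps * (c * z `^ alpha)) =
  eps * c * (z `^ (- alpha) * z `^ alpha) by ring.
rewrite zz; lra.
Qed.

End FairDrift.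

(** * Assembly of the tail and moment bounds *)

Theorem theorem3p2 (R : realType) (nJ nI : nat)
    (route : 'I_nI -> {set 'I_nJ}) (A : 'M[R]_(nJ, nI))
    (C : 'cV[R]_nJ) (kappa : 'cV[R]_nI) (alpha : R)
    (nI_gt0 : (0 < nI)%N)
    (route_neq0 : forall i, route i != finset.set0)
    (defA : A = routing_mx route)
    (rankA : \rank A = nJ)
    (C_gt0 : positive_cv C) (kappa_gt0 : positive_cv kappa)
    (alpha_gt0 : 0 < alpha) :
  exists fxi fK fK' : 'cV[R]_nI -> 'cV[R]_nI -> R,
    [/\ load_dependent fxi, load_dependent fK & load_dependent fK'] /\
    forall (mu nu : 'cV[R]_nI) (Lambda : 'cV[R]_nI -> 'cV[R]_nI)
      (P : R -> state nI -> state nI -> R) (pi : state nI -> R),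
      positive_cv mu -> positive_cv nu ->
      strictly_subcritical A C (traffic mu nu) ->
      is_fair_policy A C kappa alpha Lambda ->
      is_transition_function (flow_generator mu nu Lambda) P ->
      is_stationary P pi ->
      let eps := gap A C (traffic mu nu) in
      let xi := fxi mu nu in
      let K := fK mu nu in
      let K' := fK' mu nu in
      let B := if 1 <= alpha then K' / eps
               else K' / Num.min (eps `^ alpha^-1) eps in
      [/\ 0 < B,
          forall l : nat,
            (prob pi [set n | (B + 2 * xi * l%:R <= max_norm n)%R]
               <= ((xi / (xi + eps * K)) ^+ l.+1)%:E)%E
        & forall k : nat, (expect pi (fun n => (max_norm n ^+ k)%R) < +oo)%E].
Proof.
subst A; have Ct0 : 0 < \sum_j C j 0.
  have [j _] : exists j, j \in route (Ordinal nI_gt0) by apply/set0Pn.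
  exact: lt_le_trans (capacity_le_total C_gt0 j).
have xiC := load_continuous_xi alpha nI_gt0 kappa_gt0.
have KC := load_continuous_K alpha nI_gt0 kappa_gt0.
have K'C := load_continuous_K' nI_gt0 alpha_gt0 kappa_gt0 Ct0.
exists (xi_const kappa alpha), (K_const kappa alpha), (K'_const C kappa alpha).
split; first by split; exact: load_continuous_dependent.
move=> mu nu Lambda P pi mu0 nu0 sub fair trP stP eps xi K K' B.
have rho0 : positive_cv (traffic mu nu) by move=> i; rewrite mxE divr_gt0.
have [eps0 epsC] := gap_bounds C_gt0 route_neq0 nI_gt0 rho0 sub.
have xi0 : 0 < xi by exact: xiC.1.
have K0 : 0 < K by exact: KC.1.
have K'0 : 0 < K' by exact: K'C.1.
have B0 : 0 < B.
  rewrite /B; case: ifP => _; first by rewrite divr_gt0.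
  by rewrite divr_gt0// lt_min powR_gt0.
pose w i := weight kappa alpha i mu nu.
have w1 i : 1 <= w i by exact: weight_ge1.
have J0 : 0 < jump_bound kappa alpha mu nu by apply: (load_continuous_jump alpha nI_gt0 kappa_gt0).1.
have nu_ge0 i : 0 <= nu i 0 by exact: ltW.
have nus0 : 0 <= \sum_i nu i 0 by exact: sumr_ge0.
have eK : 0 < eps * K by rewrite mulr_gt0.
have tail (l : nat) s : uniq s -> {in s, forall n, B + 2 * xi * l%:R <= max_norm n} ->
    \sum_(n <- s) pi n <= (xi / (xi + eps * K)) ^+ l.+1.
  move=> us sB.
  have rate0 m i : 0 <= departure_rate mu Lambda m i.
    by have /andP[] := fair_rate_bounds C_gt0 route_neq0 mu0 fair m i.
  have Jxi : jump_bound kappa alpha mu nu <= xi.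
    by rewrite /xi /xi_const mulrDr mulr1 lerDl mulr_ge0// ltW.
  have Jnu : jump_bound kappa alpha mu nu * \sum_i nu i 0 <= xi.
    by rewrite /xi /xi_const mulrDr mulr1 lerDr ltW.
  (* The base level B - xi makes the first tail threshold exactly B. *)
  have down m : B - xi + xi <= lyapunov w alpha m ->
      drift mu nu Lambda (lyapunov w alpha) m <= - (eps * K).
    rewrite subrK => BL.
    apply: (fair_lyapunov_drift C_gt0 kappa_gt0 route_neq0 alpha_gt0 nI_gt0
      mu0 nu0 fair eps0 epsC BL).
    exact: lt_le_trans BL.
  apply: (stationary_geometric_tail nu_ge0 trP stP rate0 (ltW J0) Jxi Jnu xi0
    (ltW eK) (lyapunov_arrival_ge w1 alpha_gt0)
    (lyapunov_arrival_le w1 alpha_gt0) down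
    (lyapunov_sublevel_finite w1 alpha_gt0) us) => n /sB.
  rewrite subrK => /le_trans; apply; exact: max_norm_le_lyapunov.
split=> // [l|k].
  by apply: esum_le_finite => s us sB; exact: tail.
have r01 : 0 < xi / (xi + eps * K) < 1.
  by rewrite divr_gt0 ?addr_gt0//= ltr_pdivrMr ?addr_gt0// mul1r ltrDl.
have max_norm0 (n : state nI) : 0 <= max_norm n :> R by rewrite /max_norm.
have [D sD] := moment_of_geometric_tail k (ltW B0) xi0 r01 (stationary_ge0 stP)
  max_norm0 (sum_stationary_le1 stP) tail.
apply: (@le_lt_trans _ _ D%:E); last exact: ltry.
by apply: esum_le_finite => s us _; exact: sD.
Qed.
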